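(* Let $H$ satisfy the standing assumptions (H) and let $m\in\mathscr C^{1,2}_{\mathrm{per}}((0,T)\times\mathbb T^d)$ satisfy \[\int_0^T\Big(\max_{x\in\mathbb T^d}m(t,x)\Big)dt>0.\] For $\varepsilon>0$ let $\lambda_H(\varepsilon)$ be the eigenvalue of $\partial_t-\Delta+H(\nabla_x\cdot)+\frac1\varepsilon m$. Then $\lambda_H(\varepsilon)\to-\infty$ as $\varepsilon\to0$.
   Context: $\mathbb T^d$ is the $d$-dimensional torus and $T>0$ is fixed. $\mathscr C^{1,2}_{\mathrm{per}}((0,T)\times\mathbb T^d)$ denotes functions that are $T$-periodic in $t$, $\mathbb T^d$-periodic in $x$, $\mathscr C^1$ in $t$ and $\mathscr C^2$ in $x$. Standing assumptions (H) on $H:\mathbb R^d\to\mathbb R$: $H$ is $\mathscr C^2$; $H(p)>H(0)=0$ for $p\neq0$; $\nabla^2_{pp}H(p)$ is symmetric positive definite for $p\neq 0$; there is a continuous, coercive, convex, non-negative function $\mathcal H$ on $[0,\infty)$ with $\mathcal H(a)>\mathcal H(0)=0$ for $a>0$ such that $\mathcal H\big(\|f-\frac{1}{|\mathbb T^d|}\int_{\mathbb T^d}f\|_{L^1(\mathbb T^d)}\big)\le\int_{\mathbb T^d}H(\nabla f)$ for every $f\in\mathscr C^2(\mathbb T^d)$; and there is $\beta\in(0,1)$ with $aH(p)\ge H(a^\beta p)$ for all $a\in(0,1)$, $p\in\mathbb R^d$. Eigenvalue: for $g\in \mathscr C^{1,2}_{\mathrm{per}}$, the eigenvalue of $\partial_t-\Delta+H(\nabla_x\cdot)+g$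 is the unique real $\lambda$ for which there exists $\varphi\in\mathscr C^{1,2}_{\mathrm{per}}((0,T)\times\mathbb T^d)$ with $\lambda+\partial_t\varphi-\Delta\varphi+H(\nabla_x\varphi)=-g$. *)

(* Defs.v *)
From HB Require Import structures.
From mathcomp Require Import all_boot all_order all_algebra.
From mathcomp Require Import all_classical all_reals all_analysis.
Set Implicit Arguments. Unset Strict Implicit. Unset Printing Implicit Defensive.
Import Order.TTheory GRing.Theory Num.Theory.
Import numFieldNormedType.Exports.
Local Open Scope classical_set_scope.
Local Open Scope ring_scope.

Section Defs.
Variables (R : realType) (d : nat).

Definition evec (i : 'I_d) : 'rV[R]_d := delta_mx 0 i.

Definition pdx (i : 'I_d) (f : 'rV[R]_d -> R) (x : 'rV[R]_d) : R :=
  'D_(evec i) f x.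

Definition C2 (f : 'rV[R]_d -> R) : Prop :=
  continuous f /\
  (forall i x, derivable f x (evec i)) /\
  (forall i, continuous (pdx i f)) /\
  (forall i j x, derivable (pdx i f) x (evec j)) /\
  (forall i j, continuous (pdx j (pdx i f))).

(* Z^d-periodic functions on R^d, i.e. functions on the torus T^d = R^d/Z^d *)
Definition xperiodic (f : 'rV[R]_d -> R) : Prop :=
  forall i x, f (x + evec i) = f x.

Definition grad (f : 'rV[R]_d -> R) (x : 'rV[R]_d) : 'rV[R]_d :=
  \row_i pdx i f x.

Definition lapl (f : 'rV[R]_d -> R) (x : 'rV[R]_d) : R :=
  \sum_(i < d) pdx i (pdx i f) x.

Definition dt (phi : R -> 'rV[R]_d -> R) (t : R) (x : 'rV[R]_d) : R :=
  'D_1 (fun s => phi s x) t.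

Definition C12per (T : R) (phi : R -> 'rV[R]_d -> R) : Prop :=
  (forall t x, phi (t + T) x = phi t x) /\
  (forall t, xperiodic (phi t)) /\
  continuous (fun p : R * 'rV[R]_d => phi p.1 p.2) /\
  (forall t x, derivable (fun s => phi s x) t 1) /\
  continuous (fun p : R * 'rV[R]_d => dt phi p.1 p.2) /\
  (forall i t x, derivable (phi t) x (evec i)) /\
  continuous (fun p : R * 'rV[R]_d => grad (phi p.1) p.2) /\
  (forall i j t x, derivable (pdx i (phi t)) x (evec j)) /\
  (forall i j, continuous (fun p : R * 'rV[R]_d => pdx j (pdx i (phi p.1)) p.2)).

End Defs.

(* Integral over the unit cube [0,1]^n (a fundamental domain of T^n, of
   measure 1), as an iterated Lebesgue integral over [0,1] in each coordinate.
   F receives the coordinates as a sequence nat -> R. *)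
Fixpoint cube_int (R : realType) (n : nat) (F : (nat -> R) -> R) : R :=
  match n with
  | 0 => F (fun _ => 0)
  | n'.+1 => Rintegral (@lebesgue_measure R) `[0%R, 1%R]
      (fun s => cube_int n' (fun y => F (fun k => if k == n' then s else y k)))
  end.

Definition torus_int (R : realType) (d : nat) (f : 'rV[R]_d -> R) : R :=
  cube_int d (fun y => f (\row_i y (nat_of_ord i))).

Definition assumptionH (R : realType) (d : nat) (H : 'rV[R]_d -> R) : Prop :=
  C2 H /\
  H 0 = 0 /\ (forall p, p != 0 -> H p > 0) /\
  (forall p, p != 0 ->
     (forall i j, pdx j (pdx i H) p = pdx i (pdx j H) p) /\
     (forall v : 'rV[R]_d, v != 0 ->
        \sum_(i < d) \sum_(j < d) v 0 i * v 0 j * pdx j (pdx i H) p > 0)) /\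
  (exists calH : R -> R,
     {within [set a | 0 <= a], continuous calH} /\
     (calH a @[a --> +oo] --> +oo)%classic /\
     (forall a b l, 0 <= a -> 0 <= b -> 0 <= l -> l <= 1 ->
        calH (l * a + (1 - l) * b) <= l * calH a + (1 - l) * calH b) /\
     (forall a, 0 <= a -> 0 <= calH a) /\
     calH 0 = 0 /\ (forall a, 0 < a -> 0 < calH a) /\
     (forall f : 'rV[R]_d -> R, C2 f -> xperiodic f ->
        calH (torus_int (fun x => `|f x - torus_int f|))
          <= torus_int (fun x => H (grad f x)))) /\
  (exists beta : R, 0 < beta < 1 /\
     forall a p, 0 < a -> a < 1 -> a * H p >= H ((a `^ beta) *: p)).

Definition is_eigenvalue (R : realType) (d : nat) (T : R)
    (H : 'rV[R]_d -> R) (g : R -> 'rV[R]_d -> R) (lambda : R) : Prop :=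
  exists phi : R -> 'rV[R]_d -> R, C12per T phi /\
    forall t x, lambda + dt phi t x - lapl (phi t) x + H (grad (phi t) x)
                = - g t x.

Definition xmax (R : realType) (d : nat) (m : R -> 'rV[R]_d -> R) (t : R) : R :=
  sup [set m t x | x in [set: 'rV[R]_d]].

(* Main.v *)
(* If lambda stayed above -M along eps -> 0, integrating the equation would bound
   eps * int int H(grad phi), so the superlinearity a H(p) >= H(a^beta p) and the
   Poincare-type inequality for H would bound eps^beta times the L^1 oscillation of phi.
   Test the equation against a smooth time-periodic family r(t, .) of probability densities
   and drop H >= 0: the spatial mean of phi does not contribute since r has unit mass, so
   int int r m <= O(eps) + O(eps^(1 - beta)).  For the Gibbs densities
   r = exp(K m) / int exp(K m), which inherit the regularity of m, the left-hand side
   tends to int max_x m > 0 as K -> oo, a contradiction. *)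
Require Import Defs.
From HB Require Import structures.
From mathcomp Require Import all_boot all_order all_algebra.
From mathcomp Require Import all_classical all_reals all_analysis.
From mathcomp Require Import ring lra.
Import Order.TTheory GRing.Theory Num.Theory.
Import numFieldNormedType.Exports.
Local Open Scope classical_set_scope.
Local Open Scope ring_scope.

Set Implicit Arguments.
Unset Strict Implicit.
Unset Printing Implicit Defensive.

(** A point where [m t] is maximal need not depend continuously on [t], whereas the test weight must
    be differentiated in time and must return to itself after time [T]. A Gibbs density avoids
    selecting such a point. Its loss against the maximum is quantified, of order [log K / K]
    uniformly over a period, so one fixed [K] already makes the weighted integral of [m] positive.
    The weight is therefore chosen before [eps], and all constants derived from it are independent
    of [eps]. The exponent [1 - beta] comes from writing [eps] as [eps^(1 - beta) * eps^beta]: after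
    multiplication of the tested equation by [eps], the oscillation of [phi] carries the factor
    [eps]; the energy bound controls [eps^beta] times the oscillation, and [eps^(1 - beta)] is left
    over. The Poincare-type inequality is nonlinear and holds at each fixed time. Convexity turns it
    into an affine lower bound, [calH a >= calH 1 * (a - 1)], which can be integrated in time. *)

Notation itv_int a b f := (Rintegral (@lebesgue_measure _) `[a, b] f).

(** * Interval integrals, and their dependence on parameters *)

Lemma continuous_integrable (R : realType) (a b : R) (f : R -> R) :
  continuous f -> (@lebesgue_measure R).-integrable `[a, b] (EFin \o f).
Proof.
move=> cf; apply: continuous_compact_integrable; first exact: segment_compact.
exact: continuous_subspaceT.
Qed.

Lemma itv_intD (R : realType) (a b : R) (f g : R -> R) :
  continuous f -> continuous g ->
  itv_int a b (fun s => f s + g s) = itv_int a b f + itv_int a b g.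
Proof. by move=> cf cg; rewrite RintegralD//; exact: continuous_integrable. Qed.

Lemma itv_intZ (R : realType) (a b k : R) (f : R -> R) :
  continuous f -> itv_int a b (fun s => k * f s) = k * itv_int a b f.
Proof. by move=> cf; rewrite RintegralZl//; exact: continuous_integrable. Qed.

Lemma itv_int_cst (R : realType) (a b k : R) : a <= b ->
  itv_int a b (fun=> k) = k * (b - a).
Proof.
move=> ab; rewrite Rintegral_cst//.
congr (_ * _); rewrite -[RHS]/(fine (b - a)%:E); congr fine.
apply: etrans (@lebesgue_measure_itv R `[a, b]) _; rewrite /= lte_fin.
by case: ltgtP ab => // -> _; rewrite subrr.
Qed.

Lemma le_itv_int (R : realType) (a b : R) (f g : R -> R) :
  continuous f -> continuous g -> (forall s, a <= s <= b -> f s <= g s) ->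
  itv_int a b f <= itv_int a b g.
Proof.
move=> cf cg fg; apply: le_Rintegral; [by []|exact: continuous_integrable..|].
by move=> s; rewrite /= in_itv/= => /fg.
Qed.

(** The tube lemma in metric form: around each point [x] of the compact set, both values are within
    [e / 2] of [F p0 x]. It gives uniformity for parametrised integrals and for the spatial
    maximum. *)
Lemma near_tube (R : realType) (P X : topologicalType) (K : set X)
    (F : P -> X -> R) (p0 : P) (e : R) :
  compact K -> continuous (fun q : P * X => F q.1 q.2) -> 0 < e ->
  \forall p \near p0, forall x, K x -> `|F p0 x - F p x| < e.
Proof.
move=> cK cF e0.
have e2 : 0 < e / 2 by rewrite divr_gt0.
move: cK => /compact_near_coveringP/(_ P (nbhs p0)
    (fun p x => `|F p0 x - F p x| < e) _).
have H (x : X) : K x ->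
    \forall x' \near x & i \near nbhs p0, `|F p0 x' - F i x'| < e.
  move=> _.
  have /cvgrPdist_lt/(_ _ e2) := cF (p0, x).
  move=> [[A B] /= [p0A sB] AB].
  exists (B, A) => //= -[x' p] [/= Bx' Ap].
  have h1 := AB (p, x') (conj Ap Bx').
  have h2 := AB (p0, x') (conj (nbhs_singleton p0A) Bx').
  rewrite /= in h1 h2.
  rewrite (_ : _ - _ = (F p0 x - F p x') - (F p0 x - F p0 x')); last by ring.
  by rewrite (le_lt_trans (ler_normB _ _))// (splitr e) ltrD.
by move=> /(_ H).
Qed.

Lemma continuous_compose (T1 T2 T3 : topologicalType) (f : T1 -> T2) (g : T2 ->
  T3) :
  continuous f -> continuous g -> continuous (fun x => g (f x)).
Proof.
by move=> cf cg x; apply: continuous_comp; [exact: cf|exact: cg].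
Qed.

Lemma continuous_pair (T1 T2 T3 : topologicalType) (f : T1 -> T2) (g : T1 ->
  T3) :
  continuous f -> continuous g -> continuous (fun x => (f x, g x)).
Proof. by move=> cf cg x; apply: cvg_pair; [exact: cf|exact: cg]. Qed.

Lemma continuous_idf (T : topologicalType) : continuous (fun x : T => x).
Proof. by move=> x; exact: cvg_id. Qed.

Lemma continuous_cstf (T1 T2 : topologicalType) (c : T2) : continuous (fun _ :
  T1 => c).
Proof. by move=> x; exact: cvg_cst. Qed.

Lemma continuous_fstf (T T1 T2 : topologicalType) (f : T -> T1 * T2) :
  continuous f -> continuous (fun x => (f x).1).
Proof. by move=> cf; apply: (continuous_compose cf) => x; exact: cvg_fst. Qed.

Lemma continuous_sndf (T T1 T2 : topologicalType) (f : T -> T1 * T2) :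
  continuous f -> continuous (fun x => (f x).2).
Proof. by move=> cf; apply: (continuous_compose cf) => x; exact: cvg_snd. Qed.

Lemma continuous_addf (R : realType) (T : topologicalType) (W : normedModType R)
    (f g : T -> W) :
  continuous f -> continuous g -> continuous (fun x => f x + g x).
Proof. by move=> cf cg x; apply: cvgD; [exact: cf|exact: cg]. Qed.

Lemma continuous_scalef (R : realType) (T : topologicalType) (W : normedModType
  R)
    (f : T -> R) (g : T -> W) :
  continuous f -> continuous g -> continuous (fun x => f x *: g x).
Proof. by move=> cf cg x; apply: cvgZ; [exact: cf|exact: cg]. Qed.

Lemma continuous_mulf (R : realType) (T : topologicalType) (f g : T -> R) :
  continuous f -> continuous g -> continuous (fun x => f x * g x).
Proof. exact: continuous_scalef. Qed.

Lemma continuous_section (T1 T2 T3 : topologicalType) (F : T1 -> T2 -> T3)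
    (x : T1) :
  continuous (fun q : T1 * T2 => F q.1 q.2) -> continuous (F x).
Proof.
move=> cF; apply: (@continuous_compose _ _ _ (fun y => (x, y)) (fun q =>
  F q.1 q.2)) => //.
by apply: continuous_pair; [exact: continuous_cstf|exact: continuous_idf].
Qed.

Lemma continuous_itv_int (R : realType) (P : topologicalType) (F : P -> R -> R)
  :
  continuous (fun q : P * R => F q.1 q.2) ->
  continuous (fun p => itv_int 0 1 (F p)).
Proof.
move=> cF p0; apply/cvgrPdist_le => e e0.
have c1 p : continuous (F p) by exact: continuous_section.
near=> p.
have h : forall s, 0 <= s <= 1 -> `|F p0 s - F p s| < e.
  near: p.
  have := near_tube p0 (@segment_compact R 0 1) cF e0.
  by apply: filterS => p h s s01; apply: h; rewrite /= in_itv.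
have i1 q := continuous_integrable 0 1 (c1 q).
rewrite -RintegralB//.
have i2 : (@lebesgue_measure R).-integrable `[0, 1]
    (EFin \o (fun s => F p0 s - F p s)).
  by apply: continuous_integrable => s; apply: cvgB; exact: c1.
rewrite (le_trans (le_normr_Rintegral _ i2))//.
have -> : e = itv_int 0 1 (fun=> e) by rewrite itv_int_cst// subr0 mulr1.
apply: le_itv_int.
- by move=> s; apply: cvg_norm; apply: cvgB; exact: c1.
- by move=> s; exact: cvg_cst.
- by move=> s s01; exact/ltW/h.
Unshelve. all: by end_near. Qed.

Lemma itv_int_FTC2 (R : realType) (a b : R) (f g : R -> R) : a < b ->
  continuous g -> (forall s : R, is_derive s 1 f (g s)) ->
  itv_int a b g = f b - f a.
Proof.
move=> ab cg df.
have dv s : derivable f s 1 by have [] := df s.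
have cf : continuous f.
  by move=> s; apply: differentiable_continuous; exact/derivable1_diffP.
rewrite /Rintegral (@continuous_FTC2 _ g f)//.
- exact: continuous_subspaceT.
- split.
  + by move=> s _; exact: dv.
  + by apply: cvg_at_right_filter; exact: cf.
  + by apply: cvg_at_left_filter; exact: cf.
- by move=> s _; rewrite derive1E derive_val.
Qed.

(** Dominated differentiation: [G] is bounded on the compact box [[u - 1, u + 1] * [0, 1]], and that
    bound is the integrable majorant. *)
Lemma is_derive_itv_int (R : realType) (F G : R -> R -> R) (u : R) :
  continuous (fun q : R * R => F q.1 q.2) ->
  continuous (fun q : R * R => G q.1 q.2) ->
  (forall u s : R, is_derive u 1 (F^~ s) (G u s)) ->
  is_derive u 1 (fun u => itv_int 0 1 (F u)) (itv_int 0 1 (G u)).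
Proof.
move=> cF cG dF.
have [C hC] : exists C, forall v s, u - 1 <= v <= u + 1 -> 0 <= s <= 1 ->
    `|G v s| <= C.
  have cK : compact (`[u - 1, u + 1]%classic `*` `[0, 1]%classic : set (R * R)).
    by apply: compact_setX; exact: segment_compact.
  have /compact_bounded := continuous_compact (continuous_subspaceT cG) cK.
  move=> [M [Mr h]]; exists (M + 1) => v s hv hs.
  apply: (h (M + 1)); first by rewrite ltrDl.
  by exists (v, s) => //=; split => /=; rewrite in_itv.
pose C' := Num.max C 0.
have pE x y : partial1of2 F x y = G x y.
  by rewrite partial1of2E; have [_] := dF x y.
have Iu : `]u - 1, u + 1[%classic u.
  by rewrite /= in_itv/=; apply/andP; split; lra.
have H1 : forall x, `]u - 1, u + 1[%classic x ->
    (@lebesgue_measure R).-integrable `[0, 1] (EFin \o F x).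
  by move=> x _; apply/continuous_integrable/continuous_section.
have H2 : forall x y, `]u - 1, u + 1[%classic x -> `[0, 1]%classic y ->
    derivable (F^~ y) x 1 by move=> x y _ _; have [] := dF x y.
have H3 : forall y : R, 0 <= (fun=> C') y by move=> _; rewrite le_max lexx orbT.
have H4 : (@lebesgue_measure R).-integrable `[0, 1] (EFin \o fun=> C').
  by apply: continuous_integrable => x; exact: cvg_cst.
have H5 : forall x y, `]u - 1, u + 1[%classic x -> `[0, 1]%classic y ->
    `|partial1of2 F x y| <= (fun=> C') y.
  move=> x y; rewrite /= !in_itv/= => /andP[x1 x2] hy; rewrite pE.
  by rewrite le_max hC// !ltW.
have m01 : measurable (`[0, 1]%classic : set (measurableTypeR R)).
  exact: measurable_itv.
apply: DeriveDef.
  exact: (derivable_under_integral m01 Iu H1 H2 H3 H4 H5).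
rewrite -derive1E (differentiation_under_integral m01 Iu H1 H2 H3 H4 H5).
by apply: eq_Rintegral => y _; rewrite pE.
Qed.

Section derivation_rules.
Context {R : realType} {W : normedModType R}.
Implicit Types (f g : W -> R) (x v : W) (a b c : R).

Lemma is_deriveDf f g x v a b : is_derive x v f a -> is_derive x v g b ->
  is_derive x v (fun y => f y + g y) (a + b).
Proof. exact: is_deriveD. Qed.

Lemma is_deriveMf f g x v a b : is_derive x v f a -> is_derive x v g b ->
  is_derive x v (fun y => f y * g y) (f x * b + g x * a).
Proof. exact: is_deriveM. Qed.

Lemma is_deriveZf c f x v a : is_derive x v f a ->
  is_derive x v (fun y => c * f y) (c * a).
Proof. exact: is_deriveZ. Qed.

End derivation_rules.

Lemma is_derive_idf (R : realType) (s : R) : is_derive s 1 (fun s : R => s) 1.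
Proof. exact: is_derive_id. Qed.

(** * The torus integral as iterated coordinate averages *)

Section torus.
Context {R : realType} {d : nat}.
Local Notation V := 'rV[R]_d.

(** The two difference quotients coincide as functions of [h]. This reduces directional derivatives
    to one-variable calculus: chain rule, fundamental theorem, mean value theorem. *)
Lemma is_derive_line (f : V -> R) (x v : V) (s a : R) :
  is_derive s 1 (fun s => f (x + s *: v)) a <-> is_derive (x + s *: v) v f a.
Proof.
have E : (fun h : R => h^-1 *: (f (x + (h *: (1:R) + s) *: v) - f (x + s *: v)))
    = (fun h : R => h^-1 *: (f (h *: v + (x + s *: v)) - f (x + s *: v))).
  apply/funext => h; congr (_ *: (f _ - _)).
  by rewrite scaler1 scalerDl addrCA.
by split=> -[dv vl]; split; move: dv vl; rewrite /derivable /derive /= E.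
Qed.

Lemma continuous_row (P : topologicalType) (g : 'I_d -> P -> R) :
  (forall i, continuous (g i)) -> continuous (fun p => \row_i g i p : V).
Proof.
move=> cg p; apply/cvg_ballP => e e0.
have : \forall q \near p, forall i, ball (g i p) e (g i q).
  by apply: filter_forall => i; have /cvg_ballP := cg i p; apply.
by apply: filterS => q h; split=> // i j; rewrite !mxE.
Qed.

(** The index is a plain [nat] so that averages can be iterated by induction; outside the range of
    coordinates, [x] is returned unchanged. *)
Definition set_coord (k : nat) (s : R) (x : V) : V :=
  \row_i (if nat_of_ord i == k then s else x 0 i).

Lemma continuous_set_coord (P : topologicalType) (k : nat) (s : P -> R) (x : P
  -> V) :
  continuous s -> continuous x -> continuous (fun p => set_coord k (s p) (x p)).
Proof.
move=> cs cx; apply: continuous_row => i; case: (nat_of_ord i == k) => //.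
apply: (@continuous_compose _ _ _ x (fun M : V => M 0 i) cx);
  exact: coord_continuous.
Qed.

Lemma set_coordE (k : 'I_d) (s : R) (x : V) : set_coord k s x = set_coord k 0 x
  + s *: evec R k.
Proof.
apply/rowP => i; rewrite !mxE; case: eqP => [/val_inj ->|/eqP].
  by rewrite !eqxx mulr1 add0r.
by move=> /eqP ik; rewrite (_ : i == k = false) ?andbF ?mulr0 ?addr0//;
  apply/eqP => e; apply: ik; rewrite e.
Qed.

Lemma set_coord_id (k : 'I_d) (x : V) : set_coord k 0 x + x 0 k *: evec R k = x.
Proof.
rewrite -set_coordE; apply/rowP => i; rewrite mxE.
by case: eqP => // /val_inj ->.
Qed.

Lemma set_coord_shift (j : 'I_d) (k : nat) (s h : R) (x : V) :
  set_coord k s (x + h *: evec R j) =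
  if nat_of_ord j == k then set_coord k s x else set_coord k s x + h *: evec R
    j.
Proof.
apply/rowP => i; case: eqP => [jk|/eqP jk]; rewrite !mxE; case: eqP => // ik.
  rewrite (_ : i == j = false) ?andbF ?mulr0 ?addr0//.
  by apply/eqP => ij; apply: ik; rewrite ij.
by rewrite (_ : i == j = false) ?andbF ?mulr0 ?addr0//;
  apply/eqP => ij; move: jk; rewrite -ij ik eqxx.
Qed.

(* Keeping the averaged coordinate as a dummy variable makes the cube integral an
   iteration of operators on functions on R^d; each commutes with the derivatives in
   the other coordinates, which replaces any use of Fubini's theorem. *)
Definition avg (k : nat) (f : V -> R) (x : V) : R :=
  itv_int 0 1 (fun s => f (set_coord k s x)).

Fixpoint avgn (n : nat) (f : V -> R) : V -> R :=
  if n is n'.+1 then avg n' (avgn n' f) else f.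

(** The induction needs a base point: coordinates below [n] are integration variables, the others
    stay frozen at [x]. When [n = d] nothing is frozen, so the base point becomes arbitrary. *)
Lemma cube_int_avgn (n : nat) (f : V -> R) (x : V) :
  cube_int n (fun y => f (\row_i (if (i < n)%N then y i else x 0 i))) =
  avgn n f x.
Proof.
elim: n x => [x|n ih x] /=.
  by congr f; apply/rowP => i; rewrite mxE.
apply: eq_Rintegral => s _; rewrite -ih; congr cube_int.
apply/funext => y; congr f; apply/rowP => i; rewrite !mxE ltnS leq_eqVlt.
by case: eqP => //= ->; rewrite ltnn.
Qed.

Lemma torus_int_avgn (f : V -> R) (x : V) : torus_int f = avgn d f x.
Proof.
rewrite -cube_int_avgn /torus_int; congr cube_int; apply/funext => y.
by congr f; apply/rowP => i; rewrite !mxE ltn_ord.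
Qed.

Lemma continuous_avg (P : topologicalType) (k : nat) (f : P -> V -> R) :
  continuous (fun q : P * V => f q.1 q.2) ->
  continuous (fun q : P * V => avg k (f q.1) q.2).
Proof.
move=> cf; apply: (@continuous_itv_int R (P * V)%type
   (fun (q : P * V) s => f q.1 (set_coord k s q.2))).
apply: (@continuous_compose _ _ _ (fun r : (P * V) * R =>
  (r.1.1, set_coord k r.2 r.1.2))
  (fun q => f q.1 q.2) _ cf).
apply: continuous_pair; first by do 2 apply: continuous_fstf;
  exact: continuous_idf.
apply: continuous_set_coord; first by apply: continuous_sndf;
  exact: continuous_idf.
by apply: continuous_sndf; apply: continuous_fstf; exact: continuous_idf.
Qed.

Lemma continuous_avgn (P : topologicalType) (n : nat) (f : P -> V -> R) :
  continuous (fun q : P * V => f q.1 q.2) ->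
  continuous (fun q : P * V => avgn n (f q.1) q.2).
Proof.
by move=> cf; elim: n => //= n; exact: (@continuous_avg P n (avgn n \o f)).
Qed.

Lemma continuous_right (T1 T2 T3 : topologicalType) (f : T2 -> T3) :
  continuous f -> continuous (fun q : T1 * T2 => f q.2).
Proof. by apply: (@continuous_compose _ _ _ snd); apply: continuous_sndf;
  exact: continuous_idf. Qed.

Lemma continuous_avgn0 (n : nat) (f : V -> R) :
  continuous f -> continuous (avgn n f).
Proof.
move=> cf; apply: (@continuous_section R V R (fun=> avgn n f) 0).
by apply: (@continuous_avgn R n (fun=> f)); exact: continuous_right.
Qed.

Lemma continuous_avgn_set_coord (n k : nat) (f : V -> R) (x : V) :
  continuous f -> continuous (fun s => avgn n f (set_coord k s x)).
Proof.
move=> cf; apply: (@continuous_compose _ _ _ (fun s =>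
  set_coord k s x) (avgn n f)).
  by apply: continuous_set_coord;
    [exact: continuous_idf|exact: continuous_cstf].
exact: continuous_avgn0.
Qed.

Lemma continuous_torus_int (P : topologicalType) (f : P -> V -> R) :
  continuous (fun q : P * V => f q.1 q.2) ->
  continuous (fun p => torus_int (f p)).
Proof.
move=> cf; rewrite (_ : (fun p => _) = (fun p => avgn d (f p) 0)); last first.
  by apply/funext => p; rewrite (torus_int_avgn _ 0).
apply: (@continuous_compose P (P * V)%type R (fun p => (p, 0 : V))
  (fun q => avgn d (f q.1) q.2)).
  by apply: continuous_pair; [exact: continuous_idf|exact: continuous_cstf].
exact: continuous_avgn.
Qed.

Lemma avgnD (n : nat) (f g : V -> R) : continuous f -> continuous g ->
  avgn n (fun x => f x + g x) = (fun x => avgn n f x + avgn n g x).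
Proof.
move=> cf cg; elim: n => //= n ->; apply/funext => x.
by rewrite /avg itv_intD//; exact: continuous_avgn_set_coord.
Qed.

Lemma avgnZ (n : nat) (k : R) (f : V -> R) : continuous f ->
  avgn n (fun x => k * f x) = (fun x => k * avgn n f x).
Proof.
move=> cf; elim: n => //= n ->; apply/funext => x.
by rewrite /avg itv_intZ//; exact: continuous_avgn_set_coord.
Qed.

Lemma avgn_cst (n : nat) (k : R) : avgn n (fun=> k) = (fun=> k).
Proof.
by elim: n => //= n ->; apply/funext => x;
  rewrite /avg itv_int_cst// subr0 mulr1.
Qed.

Lemma le_avgn (n : nat) (f g : V -> R) : continuous f -> continuous g ->
  (forall x, f x <= g x) -> forall x, avgn n f x <= avgn n g x.
Proof.
move=> cf cg fg; elim: n => //= n ih x.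
by apply: le_itv_int => // ; exact: continuous_avgn_set_coord.
Qed.

Lemma torus_intD (f g : V -> R) : continuous f -> continuous g ->
  torus_int (fun x => f x + g x) = torus_int f + torus_int g.
Proof. by move=> cf cg; rewrite !(torus_int_avgn _ 0) avgnD. Qed.

Lemma torus_intZ (k : R) (f : V -> R) : continuous f ->
  torus_int (fun x => k * f x) = k * torus_int f.
Proof. by move=> cf; rewrite !(torus_int_avgn _ 0) avgnZ. Qed.

Lemma torus_int_cst (k : R) : torus_int (fun _ : V => k) = k.
Proof. by rewrite (torus_int_avgn _ 0) avgn_cst. Qed.

Lemma le_torus_int (f g : V -> R) : continuous f -> continuous g ->
  (forall x, f x <= g x) -> torus_int f <= torus_int g.
Proof. by move=> cf cg fg; rewrite !(torus_int_avgn _ 0); exact: le_avgn. Qed.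

Lemma is_derive_avg (k : nat) (f g : R -> V -> R) :
  continuous (fun q : R * V => f q.1 q.2) ->
  continuous (fun q : R * V => g q.1 q.2) ->
  (forall (u : R) x, is_derive u 1 (f^~ x) (g u x)) ->
  forall (u : R) x, is_derive u 1 (fun u => avg k (f u) x) (avg k (g u) x).
Proof.
move=> cf cg df u x.
have C (h : R -> V -> R) : continuous (fun q : R * V => h q.1 q.2) ->
    continuous (fun q : R * R => h q.1 (set_coord k q.2 x)).
  apply: (@continuous_compose _ _ _ (fun q : R * R => (q.1, set_coord k q.2 x))
    (fun q => h q.1 q.2)).
  apply: continuous_pair; first by apply: continuous_fstf;
    exact: continuous_idf.
  by apply: continuous_set_coord; [apply: continuous_sndf;
    exact: continuous_idf|exact: continuous_cstf].
by apply: (@is_derive_itv_int R (fun u s => f u (set_coord k s x))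
  (fun u s => g u (set_coord k s x))) => //; exact: C.
Qed.

Lemma is_derive_torus_int (f g : R -> V -> R) :
  continuous (fun q : R * V => f q.1 q.2) ->
  continuous (fun q : R * V => g q.1 q.2) ->
  (forall (u : R) x, is_derive u 1 (f^~ x) (g u x)) ->
  forall u : R, is_derive u 1 (fun u => torus_int (f u)) (torus_int (g u)).
Proof.
move=> cf cg df u.
suff H n : forall (u : R) x,
    is_derive u 1 (fun u => avgn n (f u) x) (avgn n (g u) x).
  rewrite (_ : (fun u => _) = (fun p => avgn d (f p) 0)); last first.
    by apply/funext => p; rewrite (torus_int_avgn _ 0).
  by rewrite (torus_int_avgn _ 0).
elim: n => // n ih; apply: is_derive_avg => //; exact: continuous_avgn.
Qed.

(** A relational form of [pdx]: it asserts derivability and names the derivative at once, so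
    explicit derivatives can be carried through products and averages. *)
Definition has_pdx (i : 'I_d) (f g : V -> R) : Prop :=
  forall x, is_derive x (evec R i) f (g x).

Lemma has_pdx_line (i : 'I_d) (f g : V -> R) (x : V) (s : R) :
  has_pdx i f g ->
  is_derive s 1 (fun s => f (x + s *: evec R i)) (g (x + s *: evec R i)).
Proof. by move=> h; apply/is_derive_line. Qed.

(** Translation along [i] commutes with setting another coordinate [k], so the average can be
    differentiated under the integral sign along the line through [x]. *)
Lemma has_pdx_avg (k : nat) (i : 'I_d) (f g : V -> R) :
  continuous f -> continuous g -> nat_of_ord i != k ->
  has_pdx i f g -> has_pdx i (avg k f) (avg k g).
Proof.
move=> cf cg ik fg x.
have C (h : V -> R) : continuous h ->
    continuous (fun q : R * V => h (q.2 + q.1 *: evec R i)).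
  apply: (@continuous_compose _ _ _ (fun q : R * V => q.2 + q.1 *: evec R i)).
  apply: continuous_addf; first by apply: continuous_sndf;
    exact: continuous_idf.
  by apply: continuous_scalef; [apply: continuous_fstf;
    exact: continuous_idf|exact: continuous_cstf].
have := @is_derive_avg k (fun u z => f (z + u *: evec R i))
  (fun u z => g (z + u *: evec R i)) (C _ cf) (C _ cg) _ 0 x.
have E (h : V -> R) u y :
    avg k (fun z => h (z + u *: evec R i)) y = avg k h (y + u *: evec R i).
  by apply: eq_Rintegral => s _; rewrite set_coord_shift (negPf ik).
rewrite E.
under eq_fun do rewrite E.
rewrite is_derive_line scale0r addr0; apply => u y; exact: has_pdx_line.
Qed.

(** The average is the increment of [f] over one full period. *)
Lemma avg_pdx0 (i : 'I_d) (f g : V -> R) : continuous g -> has_pdx i f g ->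
  (forall x, f (x + evec R i) = f x) -> avg i g = fun=> 0.
Proof.
move=> cg fg pf; apply/funext => x; rewrite /avg.
under eq_Rintegral do rewrite set_coordE.
apply: etrans (@itv_int_FTC2 _ 0 1 (fun s =>
  f (set_coord i 0 x + s *: evec R i))
  (fun s => g (set_coord i 0 x + s *: evec R i)) ltr01 _ _) _.
- apply: (@continuous_compose R V R (fun s =>
  set_coord i 0 x + s *: evec R i) g _ cg).
  apply: continuous_addf; first exact: continuous_cstf.
  by apply: continuous_scalef; [exact: continuous_idf|exact: continuous_cstf].
- by move=> s; exact: has_pdx_line.
- by rewrite scale1r scale0r addr0 pf subrr.
Qed.

Lemma xperiodic_avg (k : nat) (f : V -> R) (i : 'I_d) :
  (forall x, f (x + evec R i) = f x) ->
  forall x, avg k f (x + evec R i) = avg k f x.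
Proof.
move=> pf x; apply: eq_Rintegral => s _.
by rewrite -[evec R i]scale1r set_coord_shift; case: eqP => // _;
  rewrite scale1r pf.
Qed.

Lemma has_pdx_avgn (n : nat) (i : 'I_d) (f g : V -> R) :
  continuous f -> continuous g -> (n <= i)%N ->
  has_pdx i f g -> has_pdx i (avgn n f) (avgn n g).
Proof.
move=> cf cg + fg; elim: n => //= n ih ni.
apply: has_pdx_avg; rewrite ?gtn_eqF//; try exact: continuous_avgn0.
by apply: ih; exact: ltnW.
Qed.

(** Averages over the coordinates before [i] keep [g] a derivative in direction [i]; the average
    over coordinate [i] then annihilates it, and later averages preserve zero. *)
Lemma torus_int_pdx (i : 'I_d) (f g : V -> R) :
  continuous f -> continuous g -> has_pdx i f g ->
  (forall x, f (x + evec R i) = f x) -> torus_int g = 0.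
Proof.
move=> cf cg fg pf; rewrite (torus_int_avgn _ 0).
suff H n : (i < n)%N -> avgn n g = fun=> 0 by rewrite H.
elim: n => //= n ih; rewrite ltnS leq_eqVlt => /orP[/eqP <-|/ih ->].
  apply: (@avg_pdx0 i (avgn i f)); first exact: continuous_avgn0.
    exact: has_pdx_avgn.
  by elim: (nat_of_ord i) => //= m; exact: xperiodic_avg.
by apply/funext => x; rewrite /avg itv_int_cst// mul0r.
Qed.

End torus.

(** * Periodic functions: lower bounds for averages, compactness, spatial maximum *)

(** As a function of [a] the left-hand side has derivative [f (a + 1) - f a], which periodicity
    makes zero. *)
Lemma itv_int_shift_periodic (R : realType) (f g : R -> R) (a : R) :
  continuous f -> continuous g -> (forall s : R, is_derive s 1 f (g s)) ->
  (forall s, f (s + 1) = f s) ->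
  itv_int 0 1 (fun s => f (a + s)) = itv_int 0 1 f.
Proof.
move=> cf cg fg pf.
have cS : continuous (fun q : R * R => q.1 + q.2).
  by apply: continuous_addf; [apply: continuous_fstf;
    exact: continuous_idf|apply: continuous_sndf; exact: continuous_idf].
have sh (b s : R) : is_derive s 1 (fun s => f (b + s)) (g (b + s)).
  have h : is_derive s 1 (fun s => b + s) 1.
    by rewrite -[X in is_derive _ _ _ X]add0r; apply: is_deriveDf;
      exact: is_derive_idf.
  by rewrite -[g _]mulr1; apply: (@is_derive1_comp _ f).
have P' (u : R) : is_derive u 1 (fun u => itv_int 0 1 (fun s => f (u + s))) 0.
  have := @is_derive_itv_int R (fun u s => f (u + s)) (fun u s => g (u + s)) u
    (continuous_compose cS cf) (continuous_compose cS cg).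
  rewrite (@itv_int_FTC2 _ 0 1 (fun s => f (u + s)))//.
  - rewrite addr0 pf subrr; apply => b s.
    by under eq_fun do rewrite addrC; rewrite addrC.
  - by apply: (continuous_compose (continuous_addf (@continuous_cstf _ _ u)
    (@continuous_idf _)) cg).
rewrite (is_derive_0_is_cst a 0 P'); apply: eq_Rintegral => s _.
by rewrite add0r.
Qed.

(** The integral equals [(1 - expR (- L)) / L], and [expR L >= 1 + L]. *)
Lemma itv_int_expRN (R : realType) (L : R) : 0 < L ->
  (1 + L)^-1 <= itv_int 0 1 (fun s => expR (- (L * s))).
Proof.
move=> L0.
have L1 : 0 < 1 + L by lra.
have dE (s : R) : is_derive s 1 (fun s => - L^-1 * expR (- (L * s)))
    (expR (- (L * s))).
  have h : is_derive s 1 (fun s : R => - (L * s)) (- L).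
    under eq_fun do rewrite -mulNr.
    by rewrite -[X in is_derive _ _ _ X]mulr1;
      exact: is_deriveZf (is_derive_idf s).
  have h2 : is_derive s 1 (fun s => expR (- (L * s))) (expR (- (L * s)) * - L).
    exact: (@is_derive1_comp _ expR).
  have := is_deriveZf (- L^-1) h2; congr is_derive; field.
  by rewrite gt_eqF.
have -> : itv_int 0 1 (fun s => expR (- (L * s))) = L^-1 * (1 - expR (- L)).
  rewrite (itv_int_FTC2 ltr01 _ dE); last first.
    apply: (@continuous_compose R R R (fun s => - (L * s)) expR);
      last exact: continuous_expR.
    move=> s; apply: cvgN; apply: continuous_mulf;
      [exact: continuous_cstf|exact: continuous_idf].
  by rewrite mulr0 oppr0 expR0 !mulr1; ring.
rewrite expRN -(ler_pM2l L0) mulrA mulfV ?gt_eqF// mul1r.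
have : (expR L)^-1 <= (1 + L)^-1.
  by rewrite lef_pV2 ?posrE ?expR_gt0// expR_ge1Dx.
have : L * (1 + L)^-1 = 1 - (1 + L)^-1 by field; rewrite gt_eqF.
lra.
Qed.

Section torus.
Context {R : realType} {d : nat}.
Local Notation V := 'rV[R]_d.
Implicit Types f g : V -> R.

Lemma xperiodic_int (f : V -> R) : xperiodic f ->
  forall (i : 'I_d) (z : int) x, f (x + z%:~R *: evec R i) = f x.
Proof.
move=> pf i.
have N (n : nat) x : f (x + n%:R *: evec R i) = f x.
  elim: n x => [|n ih] x; first by rewrite scale0r addr0.
  by rewrite -natr1 scalerDl scale1r addrA pf.
move=> [n|n] x; first by rewrite -pmulrn N.
by rewrite NegzE mulrNz scaleNr -pmulrn -(N n.+1 (x - _)) subrK.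
Qed.

(** One representative serves all periodic functions simultaneously, so that two of them can be
    compared at the same point of the cube. Coordinates are reduced one at a time by subtracting
    their integer part. *)
Lemma unit_cube_repr (x : V) : exists2 y : V, (forall i, 0 <= y 0 i <= 1) &
  forall f, xperiodic f -> f y = f x.
Proof.
suff H n : exists2 y : V,
    (forall i : 'I_d, (i < n)%N -> 0 <= y 0 i <= 1) &
    forall f, xperiodic f -> f y = f x.
  by have [y yI yf] := H d; exists y => // i; exact: yI.
elim: n => [|n [y yI yf]]; first by exists x.
have [dn|nd] := leqP d n.
  by exists y => // i _; apply: yI; exact: leq_trans (ltn_ord i) dn.
pose k := Ordinal nd.
exists (y + (- Num.floor (y 0 k))%:~R *: evec R k).
  move=> i; rewrite ltnS leq_eqVlt => /orP[/eqP ik|ni].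
    have -> : i = k by exact: val_inj.
    have /andP[] := floor_itv (y 0 k).
    rewrite !mxE !eqxx/= mulr1 mulrNz intrD => h1 h2.
    by apply/andP; split; lra.
  rewrite !mxE (_ : i == k = false) ?andbF ?mulr0 ?addr0 ?yI//.
  by apply/eqP => e; move: ni; rewrite e ltnn.
by move=> f pf; rewrite xperiodic_int// yf.
Qed.

Lemma compact_unit_cube : compact [set y : V | forall i, 0 <= y 0 i <= 1].
Proof.
have := @rV_compact R d (fun=> `[0, 1]%classic) (fun=> @segment_compact R 0 1).
congr compact; apply/seteqP; split=> y /= h i; have := h i; by rewrite in_itv.
Qed.

Lemma torus_bounded (f : R -> V -> R) (a b : R) :
  continuous (fun q : R * V => f q.1 q.2) -> (forall t, xperiodic (f t)) ->
  exists2 C, 0 <= C & forall t x, a <= t <= b -> `|f t x| <= C.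
Proof.
move=> cf pf.
have cK := compact_setX (@segment_compact R a b) compact_unit_cube.
have /compact_bounded := continuous_compact (continuous_subspaceT cf) cK.
move=> [M [Mr h]]; exists (Num.max (M + 1) 0);
  first by rewrite le_max lexx orbT.
move=> t x tab; have [y y01 yx] := unit_cube_repr x.
rewrite -(yx _ (pf t)) le_max (h (M + 1)) ?ltrDl//.
by exists (t, y) => //=; split => //=; rewrite in_itv.
Qed.

Lemma near_torus (P : topologicalType) (f : P -> V -> R) (p0 : P) (e : R) :
  continuous (fun q : P * V => f q.1 q.2) -> (forall t, xperiodic (f t)) ->
  0 < e -> \forall p \near p0, forall x, `|f p0 x - f p x| < e.
Proof.
move=> cf pf e0; have := near_tube p0 compact_unit_cube cf e0.
apply: filterS => p h x; have [y y01 yx] := unit_cube_repr x.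
by rewrite -(yx _ (pf p)) -(yx _ (pf p0)); exact: h.
Qed.

Lemma le_xmax (f : R -> V -> R) (t : R) (x : V) :
  continuous (fun q : R * V => f q.1 q.2) -> (forall t, xperiodic (f t)) ->
  f t x <= xmax f t.
Proof.
move=> cf pf; apply: ub_le_sup; last by exists x.
have [C _ h] := torus_bounded t t cf pf; exists C => _ [y _ <-].
by rewrite (le_trans (ler_norm _))// h// lexx.
Qed.

Lemma xmax_le (f : R -> V -> R) (t C : R) :
  (forall x, f t x <= C) -> xmax f t <= C.
Proof.
move=> h; apply: ge_sup; first by exists (f t 0), 0.
by move=> _ [x _ <-].
Qed.

(** The supremum is 1-Lipschitz for the uniform distance, and [near_torus] makes [f s] uniformly
    close to [f t]. *)
Lemma continuous_xmax (f : R -> V -> R) :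
  continuous (fun q : R * V => f q.1 q.2) -> (forall t, xperiodic (f t)) ->
  continuous (xmax f).
Proof.
move=> cf pf t; apply/cvgrPdist_le => e e0.
have := near_torus t cf pf e0; apply: filterS => s h.
rewrite ler_norml lerBlDr lerNl opprB lerBlDr; apply/andP; split;
  apply: xmax_le => x.
  have := le_xmax t x cf pf; have := h x; rewrite ltr_norml => /andP[]; lra.
have := le_xmax s x cf pf; have := h x; rewrite ltr_norml => /andP[]; lra.
Qed.

(** By periodicity the averaging window may be moved so as to start at [x]; there the decay bound
    integrates to at least [(1 + L)^-1]. *)
Lemma avg_ge (k : 'I_d) (f g : V -> R) (L : R) (x : V) : 0 < L ->
  continuous f -> continuous g -> has_pdx k f g ->
  (forall x, f (x + evec R k) = f x) -> 0 <= f x ->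
  (forall s, 0 <= s <= 1 ->
     expR (- (L * s)) * f x <= f (x + s *: evec R k)) ->
  (1 + L)^-1 * f x <= avg k f x.
Proof.
move=> L0 cf cg fg pf fx0 slow.
have cl (y : V) : continuous (fun s : R => y + s *: evec R k).
  by apply: continuous_addf; [exact: continuous_cstf|apply: continuous_scalef;
    [exact: continuous_idf|exact: continuous_cstf]].
have cE : continuous (fun s => expR (- (L * s))).
  apply: (@continuous_compose R R R (fun s => - (L * s)) expR);
    last exact: continuous_expR.
  by move=> s; apply: cvgN; apply: continuous_mulf;
    [exact: continuous_cstf|exact: continuous_idf].
have -> : avg k f x = itv_int 0 1 (fun s => f (x + s *: evec R k)).
  have p s : f (x + (s + 1) *: evec R k) = f (x + s *: evec R k).
    by rewrite scalerDl scale1r addrA pf.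
  rewrite -(@itv_int_shift_periodic R (fun s => f (x + s *: evec R k))
    (fun s => g (x + s *: evec R k)) (- x 0 k) (continuous_compose (cl x) cf)
      (continuous_compose (cl x) cg)
    (fun s => has_pdx_line x s fg) p).
  apply: eq_Rintegral => s _; rewrite set_coordE -{2}(set_coord_id k x).
  by congr f; rewrite scalerDl scaleNr addrA addrK.
apply: (@le_trans _ _ (itv_int 0 1 (fun s => f x * expR (- (L * s))))).
  by rewrite itv_intZ// mulrC ler_wpM2l// itv_int_expRN.
apply: le_itv_int.
- by apply: continuous_mulf => //; exact: continuous_cstf.
- exact: continuous_compose.
- by move=> s s01; rewrite mulrC; exact: slow.
Qed.

(** Each coordinate average costs one factor [(1 + L)^-1]. With [L] of order [K] this is the
    polynomial loss in the mass of a Gibbs density. *)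
Lemma torus_int_ge (f : V -> R) (g : 'I_d -> V -> R) (L : R) : 0 < L ->
  continuous f -> (forall i, continuous (g i)) -> (forall i,
    has_pdx i f (g i)) ->
  xperiodic f -> (forall x, 0 <= f x) ->
  (forall i x s, 0 <= s <= 1 ->
     expR (- (L * s)) * f x <= f (x + s *: evec R i)) ->
  forall x, (1 + L)^-1 ^+ d * f x <= torus_int f.
Proof.
move=> L0 cf cg fg pf f0 slow x; rewrite (torus_int_avgn _ x).
suff: forall n, (n <= d)%N -> (1 + L)^-1 ^+ n * f x <= avgn n f x by exact.
elim=> [|n ih] nd; first by rewrite expr0 mul1r.
pose k := Ordinal nd.
(* Averaging in an earlier coordinate is monotone and commutes with translation along [k], so the
   decay rate in direction [k] survives. *)
have slow' m : (m <= n)%N -> forall x s, 0 <= s <= 1 ->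
    expR (- (L * s)) * avgn m f x <= avgn m f (x + s *: evec R k).
  elim: m => [_ y s|m ihm mn y s s01]; first exact: slow.
  rewrite /= /avg -itv_intZ; last exact: continuous_avgn_set_coord.
  apply: le_itv_int.
  - by apply: continuous_mulf; [exact: continuous_cstf|exact:
    continuous_avgn_set_coord].
  - exact: continuous_avgn_set_coord.
  - move=> r _; rewrite set_coord_shift gtn_eqF//; apply: ihm => //;
    exact: ltnW.
have := @avg_ge k (avgn n f) (avgn n (g k)) L x L0 (@continuous_avgn0 _ _ n _
  cf)
  (@continuous_avgn0 _ _ n _ (cg k)) (@has_pdx_avgn _ _ n k _ _ cf (cg k)
    (leqnn n) (fg k)).
rewrite [avg k _]/(avgn n.+1 f).
have p m : forall x, avgn m f (x + evec R k) = avgn m f x.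
  by elim: m => [|m ihm]; [exact: pf|exact: xperiodic_avg].
have a0 : 0 <= avgn n f x.
  have := @le_avgn _ _ n (fun=> 0) f (@continuous_cstf _ _ 0) cf f0 x.
  by rewrite avgn_cst.
move=> /(_ (p n) a0 (slow' n (leqnn n) x)); apply: le_trans.
have c0 : 0 <= (1 + L)^-1 by rewrite invr_ge0; lra.
by rewrite exprS -mulrA ler_wpM2l//; apply/ih/ltnW.
Qed.

End torus.

(** * Continuity rules and their automation *)

Section continuity_rules.
Context {R : realType} {T : topologicalType}.
Implicit Types f g : T -> R.

Lemma continuous_oppf f : continuous f -> continuous (fun x => - f x).
Proof. by move=> cf x; apply: cvgN; exact: cf. Qed.

Lemma continuous_normf f : continuous f -> continuous (fun x => `|f x|).
Proof. by move=> cf x; apply: cvg_norm; exact: cf. Qed.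

Lemma continuous_expRf f : continuous f -> continuous (fun x => expR (f x)).
Proof. by move=> cf; apply: (continuous_compose cf);
  exact: continuous_expR. Qed.

Lemma continuous_invf f : (forall x, f x != 0) -> continuous f ->
  continuous (fun x => (f x)^-1).
Proof. by move=> f0 cf x; apply: cvgV => //; exact: cf. Qed.

Lemma continuous_sumf (I : finType) (F : I -> T -> R) :
  (forall i, continuous (F i)) -> continuous (fun x => \sum_i F i x).
Proof.
move=> cF; elim: (index_enum I) => [|i s ih].
  by under eq_fun do rewrite big_nil; exact: continuous_cstf.
by under eq_fun do rewrite big_cons; exact: continuous_addf.
Qed.

Lemma continuous_left (U : topologicalType) f :
  continuous f -> continuous (fun q : T * U => f q.1).
Proof. by move=> cf; apply: (@continuous_compose _ _ _ fst) => //;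
  exact: continuous_fstf (@continuous_idf _). Qed.

End continuity_rules.

Ltac solve_continuous := lazymatch goal with
  | |- forall y, continuous_at y (fun x => @?f x + @?g x) =>
    apply: continuous_addf; solve_continuous
  | |- forall y, continuous_at y (fun x => @?f x * @?g x) =>
    apply: continuous_mulf; solve_continuous
  | |- forall y, continuous_at y (fun x => - @?f x) => apply: continuous_oppf;
    solve_continuous
  | |- forall y, continuous_at y (fun x => `|@?f x|) =>
    apply: continuous_normf; solve_continuous
  | |- forall y, continuous_at y (fun x => expR (@?f x)) =>
    apply: continuous_expRf; solve_continuous
  | |- forall y, continuous_at y (fun x => \sum_(i : _) _) =>
      apply: continuous_sumf => ?; solve_continuous
  | |- _ => first [assumption | solve [auto] | exact: continuous_idf | exact:
    continuous_cstf]
  end.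

(** * Space-time periodic families with explicit derivatives *)

Section torus.
Context {R : realType} {d : nat}.
Local Notation V := 'rV[R]_d.

Lemma is_derive_unique (W : normedModType R) (f : W -> R) (x v : W) (a b : R) :
  is_derive x v f a -> is_derive x v f b -> a = b.
Proof. by move=> [_ <-] [_ <-]. Qed.

Lemma xperiodic_has_pdx (i : 'I_d) (f g : V -> R) :
  xperiodic f -> has_pdx i f g -> xperiodic g.
Proof.
move=> pf fg j x.
have h1 := has_pdx_line (x + evec R j) 0 fg.
have h2 := has_pdx_line x 0 fg.
rewrite !scale0r !addr0 in h1 h2.
apply: is_derive_unique h1 _; move: h2; congr is_derive; apply/funext => s.
by rewrite addrAC pf.
Qed.

Lemma xperiodic_dt (f ft : R -> V -> R) :
  (forall t, xperiodic (f t)) ->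
  (forall (t : R) x, is_derive t 1 (f^~ x) (ft t x)) ->
  forall t, xperiodic (ft t).
Proof.
move=> pf dft t i x; apply: is_derive_unique (dft t (x + evec R i)) _.
have -> : f^~ (x + evec R i) = f^~ x by apply/funext => s; exact: pf.
exact: dft.
Qed.

(* [f1 i] and [f2 i] are the first and the pure second derivatives in [x_i]. *)
Record C12family (T : R) (f ft : R -> V -> R) (f1 f2 : 'I_d -> R -> V -> R) :
    Prop := {
  c12_cont : continuous (fun q : R * V => f q.1 q.2);
  c12_contt : continuous (fun q : R * V => ft q.1 q.2);
  c12_cont1 : forall i, continuous (fun q : R * V => f1 i q.1 q.2);
  c12_cont2 : forall i, continuous (fun q : R * V => f2 i q.1 q.2);
  c12_t : forall (t : R) x, is_derive t 1 (f^~ x) (ft t x);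
  c12_1 : forall i t, has_pdx i (f t) (f1 i t);
  c12_2 : forall i t, has_pdx i (f1 i t) (f2 i t);
  c12_per : forall t, xperiodic (f t);
  c12_T : f T = f 0
}.

Lemma C12per_family (T : R) (phi : R -> V -> R) : C12per T phi ->
  C12family T phi (dt phi) (fun i t => pdx i (phi t))
    (fun i t => pdx i (pdx i (phi t))).
Proof.
move=> [pT [px [c [dvt [ct [dv1 [c1 [dv2 c2]]]]]]]]; split => //.
- move=> i.
  have -> : (fun q : R * V => pdx i (phi q.1) q.2) =
            (fun q => (grad (phi q.1) q.2) 0 i).
    by apply/funext => q; rewrite mxE.
  apply: (@continuous_compose _ _ _ (fun q : R * V =>
    grad (phi q.1) q.2) (fun v : V => v 0 i));
    [exact: c1|exact: coord_continuous].
- by apply/funext => x; rewrite -[in LHS](add0r T) pT.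
Qed.

Lemma C12family_int_dt (T : R) f ft f1 f2 : 0 < T -> C12family T f ft f1 f2 ->
  itv_int 0 T (fun t => torus_int (ft t)) = 0.
Proof.
move=> T0 [c ct _ _ dt _ _ _ fT].
apply: etrans (@itv_int_FTC2 R 0 T (fun t => torus_int (f t)) _ T0 _ _) _.
- exact: continuous_torus_int.
- exact: is_derive_torus_int.
- by rewrite fT subrr.
Qed.

Lemma C12familyM (T : R) f ft f1 f2 g gt g1 g2 :
  C12family T f ft f1 f2 -> C12family T g gt g1 g2 ->
  C12family T (fun t x => f t x * g t x)
    (fun t x => f t x * gt t x + g t x * ft t x)
    (fun i t x => f t x * g1 i t x + g t x * f1 i t x)
    (fun i t x => (f t x * g2 i t x + g1 i t x * f1 i t x) +
                  (g t x * f2 i t x + f1 i t x * g1 i t x)).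
Proof.
move=> [c ct c1 c2 dt d1 d2 p fT] [c' ct' c1' c2' dt' d1' d2' p' fT'].
split; try by [solve_continuous|move=> i; solve_continuous].
- by move=> t x; exact: is_deriveMf.
- by move=> i t x; apply: is_deriveMf; [exact: d1|exact: d1'].
- by move=> i t x; apply: is_deriveDf; apply: is_deriveMf;
  first [exact: d1|exact: d2|exact: d1'|exact: d2'].
- by move=> t i x; rewrite p p'.
- by rewrite fT fT'.
Qed.

Lemma C12family_expR (T k : R) f ft f1 f2 :
  C12family T f ft f1 f2 ->
  C12family T (fun t x => expR (k * f t x))
    (fun t x => expR (k * f t x) * (k * ft t x))
    (fun i t x => expR (k * f t x) * (k * f1 i t x))
    (fun i t x => expR (k * f t x) * (k * f2 i t x) +
                  (k * f1 i t x) * (expR (k * f t x) * (k * f1 i t x))).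
Proof.
move=> [c ct c1 c2 dt d1 d2 p fT].
have D1 i t : has_pdx i (fun x => expR (k * f t x))
   (fun x => expR (k * f t x) * (k * f1 i t x)).
  move=> x; have := has_pdx_line x 0 (d1 i t) => /(is_deriveZf k) h.
  have := is_derive1_comp (is_derive_expR _) h.
  move=> /(is_derive_line (fun y => expR (k * f t y))).
  by rewrite scale0r addr0.
split; try by [solve_continuous|move=> i; solve_continuous].
- move=> t x; exact: is_derive1_comp (is_derive_expR _) (is_deriveZf k (dt t
  x)).
- by move=> i t x; apply: is_deriveMf;
  [exact: D1|exact: is_deriveZf (d2 i t x)].
- by move=> t i x; rewrite p.
- by rewrite fT.
Qed.

(** Meant for the normalising factor [1 / Z t] of a Gibbs density: once it is a family constant in
    space, the product rule [C12familyM] handles the quotient. *)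
Lemma C12family_time (T : R) (f ft : R -> R) : continuous f -> continuous ft ->
  (forall t : R, is_derive t 1 f (ft t)) -> f T = f 0 ->
  C12family T (fun t _ => f t) (fun t _ => ft t) (fun _ _ _ =>
    0) (fun _ _ _ => 0).
Proof.
move=> cf cft dt fT; split=> //; try by [exact: continuous_left|move=> i;
  exact: continuous_cstf].
- by move=> i t x; exact: is_derive_cst.
- by move=> i t x; exact: is_derive_cst.
- by rewrite fT.
Qed.

End torus.

(** * Gibbs densities as test weights *)

Section torus.
Context {R : realType} {d : nat}.
Local Notation V := 'rV[R]_d.

Lemma torus_int_expR_gt0 (f : V -> R) : continuous f -> xperiodic f ->
  0 < torus_int (fun x => expR (f x)).
Proof.
move=> cf pf.
have cf' : continuous (fun q : R * V => f q.2) by exact: continuous_right.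
have [C _ h] := torus_bounded (f := fun=> f) 0 0 cf' (fun=> pf).
apply: (@lt_le_trans _ _ (expR (- C))); first exact: expR_gt0.
rewrite -[leLHS](@torus_int_cst R d); apply: le_torus_int => [||x];
  try by solve_continuous.
by have := h 0 x; rewrite lexx => /(_ isT);
  rewrite ler_expR ler_norml => /andP[].
Qed.

(* The Gibbs density [expR (K * f)], once normalised, has an average of [f]
   within [O(log K / K)] of the maximum: by the tangent inequality for
   [s ln s] that average is at least [ln Z / K], where [Z] is the mass, and
   [Z] loses only a factor polynomial in [K] against the maximum of the density. *)
Lemma gibbs_average_ge (f : V -> R) (g : 'I_d -> V -> R) (L K : R) (x0 : V) :
  0 < L -> 0 < K ->
  continuous f -> (forall i, continuous (g i)) -> (forall i,
    has_pdx i f (g i)) ->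
  xperiodic f -> (forall i x, `|g i x| <= L) ->
  f x0 - d%:R * ln (1 + K * L) / K
    <= torus_int (fun x => expR (K * f x) * f x)
       / torus_int (fun x => expR (K * f x)).
Proof.
move=> L0 K0 cf cg fg pf gL; set Z := torus_int (fun x => expR (K * f x)).
have KL0 : 0 < K * L by exact: mulr_gt0.
have KL1 : 0 < 1 + K * L by lra.
have cE : continuous (fun x => expR (K * f x)) by solve_continuous.
have Z0 : 0 < Z.
  by apply: torus_int_expR_gt0; [solve_continuous|move=> i x; rewrite pf].
have lb : (1 + K * L)^-1 ^+ d * expR (K * f x0) <= Z.
  apply: (@torus_int_ge _ _ _ (fun i x => expR (K * f x) * (K * g i x))) => //.
  - by move=> i; solve_continuous.
  - move=> i x; have := has_pdx_line x 0 (fg i) => /(is_deriveZf K) h.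
    have := is_derive1_comp (is_derive_expR _) h.
    move=> /(is_derive_line (fun y => expR (K * f y))).
    by rewrite scale0r addr0.
  - by move=> i x; rewrite pf.
  (* The mean value theorem and the gradient bound [L] show that [expR (K * f)] decays at rate at
     most [K * L] along each axis. *)
  - move=> i x s /andP[s0 s1]; rewrite -expRD ler_expR.
    have [c _] := @MVT_segment _ (fun s : R => f (x + s *: evec R i))
      (fun s => g i (x + s *: evec R i)) 0 s s0
      (fun r _ => has_pdx_line x r (fg i))
      (continuous_subspaceT (continuous_compose (continuous_addf
        (@continuous_cstf _ _ x)
        (continuous_scalef (@continuous_idf _) (@continuous_cstf _ _ _))) cf)).
    rewrite scale0r addr0 subr0 => e.
    have : - (L * s) <= g i (x + c *: evec R i) * s.
      rewrite -mulNr ler_wpM2r//.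
      by have := gL i (x + c *: evec R i); rewrite ler_norml => /andP[].
    rewrite -e -(ler_pM2l K0); lra.
(* The tangent to [s ln s] is taken at [s = Z]. In the integral the terms [expR (K * f x)] and [- Z]
   cancel because [Z] is the total mass. *)
have tangent x : expR (K * f x) * ln Z + expR (K * f x) + - Z
    <= K * (expR (K * f x) * f x).
  have := expR_ge1Dx (ln Z - K * f x).
  rewrite expRD expRN lnK ?posrE// -(ler_pM2l (expR_gt0 (K * f x))).
  rewrite [X in _ <= X -> _]mulrCA mulfV ?gt_eqF ?expR_gt0// mulr1; lra.
have entropy : Z * ln Z <= K * torus_int (fun x => expR (K * f x) * f x).
  rewrite -torus_intZ; last by solve_continuous.
  have -> : Z * ln Z =
      torus_int (fun x => ln Z * expR (K * f x) + expR (K * f x) + - Z).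
    rewrite !torus_intD ?torus_int_cst ?torus_intZ -/Z; try by solve_continuous.
    by rewrite addrK mulrC.
  apply: le_torus_int => [||x]; try by solve_continuous.
  by rewrite [ln Z * _]mulrC.
have {}lb : K * f x0 - d%:R * ln (1 + K * L) <= ln Z.
  move: lb; rewrite -ler_ln ?posrE//; last first.
    by rewrite mulr_gt0 ?expR_gt0// exprn_gt0// invr_gt0.
  rewrite lnM ?posrE ?expR_gt0 ?exprn_gt0 ?invr_gt0// expRK lnXn ?invr_gt0//.
  by rewrite lnV ?posrE// mulNrn mulr_natl addrC.
rewrite ler_pdivlMr// -(ler_pM2l K0); apply: le_trans entropy.
rewrite mulrA [leRHS]mulrC ler_wpM2r ?(ltW Z0)//; apply: le_trans lb.
by rewrite mulrBr [K * (_ / _)]mulrCA mulfV ?gt_eqF// mulr1.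
Qed.

Lemma test_density (T : R) (m : R -> V -> R) : 0 < T -> C12per T m ->
  0 < itv_int 0 T (xmax m) ->
  exists r rt r1 r2, [/\ C12family T r rt r1 r2,
    forall t x, 0 <= r t x, forall t, torus_int (r t) = 1 &
    0 < itv_int 0 T (fun t => torus_int (fun x => r t x * m t x))].
Proof.
move=> T0 /C12per_family fm S0; set S := itv_int 0 T (xmax m) in S0.
have [cm ct c1 c2 dtm d1 d2 pm mT] := fm.
have [L' L'0 hL'] : exists2 L, 0 <= L & forall t x, 0 <= t <= T ->
    `|\sum_i `|pdx i (m t) x| | <= L.
  apply: (@torus_bounded _ _ (fun t x => \sum_i `|pdx i (m t) x|)).
    by solve_continuous; exact: c1.
  move=> t j x; apply: eq_bigr => i _; congr `|_|.
  exact: xperiodic_has_pdx (pm t) (d1 i t) j x.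
(* The shift ensures [L >= 1], hence [L <= L * L] and [1 + n^2 * L <= (1 + n * L)^2] below. *)
pose L := L' + 1.
have L1 : 1 <= L by rewrite /L; lra.
have hL i t x : 0 <= t <= T -> `|pdx i (m t) x| <= L.
  move=> /(hL' t x); rewrite ger0_norm; last by apply: sumr_ge0.
  rewrite (bigD1 i)//= => h.
  have : 0 <= \sum_(j < d | j != i) `|pdx j (m t) x| by exact: sumr_ge0.
  rewrite /L; lra.
have d0 : 0 <= d%:R :> R by [].
(* With [K = n^2] one gets [ln (1 + K * L) <= 2 * n * L], so the loss [c] is at most
   [2 * d * L / n]. This [n] is just large enough for [c * T < S]. *)
pose n := 2 * T * d%:R * L / S + 1.
have q0 : 0 <= 2 * T * d%:R * L / S.
  by rewrite divr_ge0 ?(ltW S0)// !mulr_ge0 ?(ltW T0)//; lra.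
have n0 : 0 < n by rewrite /n; lra.
pose K := n ^+ 2.
have K0 : 0 < K by rewrite exprn_gt0.
pose c := d%:R * ln (1 + K * L) / K.
have cS : c * T < S.
  have lnle : ln (1 + K * L) <= 2 * (n * L).
    have nL0 : 0 < n * L by rewrite mulr_gt0//; lra.
    have h1 : 1 + K * L <= (1 + n * L) ^+ 2.
      have : K * L <= K * (L * L) by rewrite ler_pM2l// ler_peMl//; lra.
      rewrite /K; nra.
    have h2 : ln (1 + K * L) <= ln ((1 + n * L) ^+ 2).
      rewrite ler_ln// posrE; last by rewrite exprn_gt0//; lra.
      by have := mulr_gt0 K0 (lt_le_trans ltr01 L1); lra.
    apply: le_trans h2 _; rewrite lnXn; last by lra.
    have : ln (1 + n * L) <= n * L by apply: le_ln1Dx; lra.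
    by rewrite mulr2n; lra.
  have c_le : c <= 2 * d%:R * L / n.
    rewrite /c ler_pdivrMr// (_ : _ / n * K = d%:R * (2 * (n * L))).
      exact: ler_wpM2l.
    by rewrite /K; field; rewrite gt_eqF.
  apply: (@le_lt_trans _ _ (2 * d%:R * L / n * T)).
    by rewrite ler_pM2r.
  have e : S * n = 2 * T * d%:R * L + S by rewrite /n; field; rewrite gt_eqF.
  by rewrite mulrAC ltr_pdivrMr// e; lra.
have fE := C12family_expR K fm.
set E := (fun t x => expR (K * m t x)) in fE.
pose Z t := torus_int (E t).
pose Z' t := torus_int (fun x => E t x * (K * dt m t x)).
have cZ : continuous Z by apply: continuous_torus_int; exact: c12_cont fE.
have cZ' : continuous Z' by apply: continuous_torus_int; exact: c12_contt fE.
have Z0 t : 0 < Z t.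
  apply: torus_int_expR_gt0; last by move=> i x; rewrite pm.
  by have := continuous_section (x := t) cm => h; solve_continuous.
have nZ t : Z t != 0 by rewrite gt_eqF.
have dZ (t : R) : is_derive t 1 Z (Z' t).
  apply: (@is_derive_torus_int R d E (fun t x => E t x * (K * dt m t x))).
  - exact: c12_cont fE.
  - exact: c12_contt fE.
have fW : C12family T (fun t (_ : V) => (Z t)^-1) (fun t _ => - Z t ^- 2 * Z' t)
    (fun (_ : 'I_d) _ _ => 0) (fun _ _ _ => 0).
  apply: C12family_time.
  - exact: continuous_invf.
  - apply: continuous_mulf => //; apply: continuous_oppf;
    apply: continuous_invf => [t|].
      by rewrite expf_neq0.
    exact: (continuous_mulf cZ cZ).
  - by rewrite /Z /E mT.
have fr := C12familyM fE fW.
do 4 eexists; split; first exact: fr.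
- by move=> t x /=; rewrite mulr_ge0 ?expR_ge0// invr_ge0 ltW.
- move=> t /=; under eq_fun do rewrite mulrC.
  rewrite torus_intZ ?mulVf//.
  exact: continuous_section (c12_cont fE).
have E1 t : torus_int (fun x => E t x / Z t * m t x) =
    torus_int (fun x => E t x * m t x) / Z t.
  under eq_fun do rewrite mulrAC mulrC.
  rewrite torus_intZ 1?mulrC//; apply: continuous_mulf.
    exact: continuous_section (c12_cont fE).
  exact: continuous_section cm.
rewrite /=; under eq_Rintegral do rewrite E1.
have cx : continuous (xmax m) by exact: continuous_xmax.
(* At each time the Gibbs average of [m] is at least [xmax m t - c], whose integral is
   [S - c * T > 0]. *)
apply: (@lt_le_trans _ _ (itv_int 0 T (fun t => xmax m t + - c))).
  rewrite itv_intD//; last by solve_continuous.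
  by rewrite itv_int_cst ?(ltW T0)// subr0 -/S; lra.
apply: le_itv_int; first by solve_continuous.
- apply: continuous_mulf; last exact: continuous_invf.
  apply: (@continuous_torus_int _ _ _ (fun t x => E t x * m t x)).
  by apply: continuous_mulf => //; exact: c12_cont fE.
move=> t tT; rewrite lerBlDr; apply: xmax_le => x; rewrite -lerBlDr.
apply: (@gibbs_average_ge (m t) (fun i => pdx i (m t)) L K x) => //.
- lra.
- exact: continuous_section cm.
- by move=> i; exact: (@continuous_section _ _ _ (fun t =>
  pdx i (m t)) t (c1 i)).
- by move=> i y; exact: hL.
Qed.

End torus.

(** * Integration by parts and the oscillation estimate *)

Section torus.
Context {R : realType} {d : nat}.
Local Notation V := 'rV[R]_d.

(** Green's identity in one direction: [f * g2 - f2 * g] is the derivative of the periodic function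
    [f * g1 - g * f1]. *)
Lemma torus_int_ibp2 (i : 'I_d) (f f1 f2 g g1 g2 : V -> R) :
  continuous f -> continuous f1 -> continuous f2 ->
  continuous g -> continuous g1 -> continuous g2 ->
  has_pdx i f f1 -> has_pdx i f1 f2 -> has_pdx i g g1 -> has_pdx i g1 g2 ->
  xperiodic f -> xperiodic g ->
  torus_int (fun x => f x * g2 x) = torus_int (fun x => f2 x * g x).
Proof.
move=> cf cf1 cf2 cg cg1 cg2 df df1 dg dg1 pf pg.
have pf1 := xperiodic_has_pdx pf df; have pg1 := xperiodic_has_pdx pg dg.
have : torus_int (fun x => (f x * g2 x + g1 x * f1 x) +
    -1 * (g x * f2 x + f1 x * g1 x)) = 0.
  apply: (@torus_int_pdx _ _ i (fun x => f x * g1 x + -1 * (g x * f1 x))).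
  - by solve_continuous.
  - by solve_continuous.
  - by move=> x; apply: is_deriveDf; [exact: is_deriveMf|apply: is_deriveZf;
    exact: is_deriveMf].
  - by move=> x; rewrite pf pg pf1 pg1.
rewrite (_ : (fun x => _) = fun x => f x * g2 x + -1 * (f2 x * g x));
  last first.
  by apply/funext => x; ring.
rewrite torus_intD ?torus_intZ; try by solve_continuous.
by lra.
Qed.

(** For [a > 1], the point 1 is the convex combination of [a] and 0 with weight [a^-1], so
    [a * h 1 <= h a]; for [a <= 1] the left-hand side is nonpositive. *)
Lemma convex_linear_minorant (h : R -> R) :
  (forall a b l, 0 <= a -> 0 <= b -> 0 <= l -> l <= 1 ->
     h (l * a + (1 - l) * b) <= l * h a + (1 - l) * h b) ->
  (forall a, 0 <= a -> 0 <= h a) -> h 0 = 0 ->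
  forall a, 0 <= a -> h 1 * (a - 1) <= h a.
Proof.
move=> cvx h_ge0 h0 a a0; have h1 := h_ge0 1 ler01; have ha := h_ge0 a a0.
have [a1|a1] := leP a 1.
  by apply: le_trans ha; rewrite mulr_ge0_le0//; lra.
have ai : 0 < a^-1 by rewrite invr_gt0; lra.
have ai1 : a^-1 <= 1 by rewrite invf_le1//; lra.
have := cvx a 0 a^-1 a0 (lexx 0) (ltW ai) ai1.
rewrite h0 !mulr0 !addr0 mulVf ?gt_eqF//; last lra.
rewrite -(ler_pM2l (lt_trans ltr01 a1)) mulrA mulfV ?gt_eqF//; last lra.
lra.
Qed.

Lemma pdxZ (k : R) (i : 'I_d) (f : V -> R) : (forall x,
  derivable f x (evec R i)) ->
  pdx i (fun x => k * f x) = (fun x => k * pdx i f x).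
Proof.
move=> df; apply/funext => x; rewrite /pdx.
by have [_ ->] := is_deriveZf k (derivableP (df x)).
Qed.

Lemma derivableMl (k : R) (x v : V) (f : V -> R) : derivable f x v ->
  derivable (fun x => k * f x) x v.
Proof. by move=> df; have [] := is_deriveZf k (derivableP df). Qed.

Lemma C2Z (k : R) (f : V -> R) : C2 f -> C2 (fun x => k * f x).
Proof.
move=> [c [df [c1 [df1 c2]]]].
have cM (h : V -> R) : continuous h -> continuous (fun x =>
  k * h x) by move=> ch; solve_continuous.
split; first exact: cM.
split; first by move=> i x; exact: derivableMl.
split; first by move=> i; rewrite pdxZ//; exact: cM.
split; first by move=> i j x; rewrite pdxZ//; exact: derivableMl.
by move=> i j; rewrite !pdxZ//; exact: cM.
Qed.

Lemma continuous_grad (f : V -> R) : C2 f -> continuous (grad f).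
Proof. by move=> [_ [_ [c1 _]]]; exact: continuous_row. Qed.

(** The Poincare-type inequality is applied to [eps^beta * f], whose energy is at most [eps] times
    that of [f] by the scaling of [H]; the affine minorant of [calH] gives [kappa = calH 1]. *)
Lemma oscillation_le (H : V -> R) : assumptionH H ->
  exists2 kappa, 0 < kappa & exists2 beta, 0 < beta < 1 &
  forall eps f, 0 < eps < 1 -> C2 f -> xperiodic f ->
    kappa * (eps `^ beta * torus_int (fun x => `|f x - torus_int f|) - 1)
      <= eps * torus_int (fun x => H (grad f x)).
Proof.
move=> [[cH _] [_ [_ [_ [[h [_ [_ [cvx [h_ge0 [h0 [h_gt0 hH]]]]]]]]
  [beta [b01 hb]]]]]].
exists (h 1); first exact: h_gt0.
exists beta => // eps f /andP[e0 e1] f2 pf.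
have cf : continuous f by case: f2.
have k0 := powR_ge0 eps beta; set k := eps `^ beta in k0 *.
have cG : continuous (fun x => H (grad f x)).
  exact: (continuous_compose (continuous_grad f2) cH).
have cA : continuous (fun x => `|f x - torus_int f|) by solve_continuous.
have := hH _ (C2Z k f2) (fun i x => congr1 _ (pf i x)).
have -> : (fun x => `|k * f x - torus_int (fun x => k * f x)|) =
    fun x => k * `|f x - torus_int f|.
  by apply/funext => x; rewrite torus_intZ// -mulrBr normrM (ger0_norm k0).
rewrite torus_intZ// => hh.
have a0 : 0 <= k * torus_int (fun x => `|f x - torus_int f|).
  rewrite mulr_ge0// -(@torus_int_cst R d 0); apply: le_torus_int => //.
  exact: continuous_cstf.
apply: le_trans (convex_linear_minorant cvx h_ge0 h0 a0) _.
apply: le_trans hh _; rewrite -torus_intZ//.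
apply: le_torus_int; [|by solve_continuous|].
  exact: (continuous_compose (continuous_grad (C2Z k f2)) cH).
move=> x; have -> : grad (fun x => k * f x) x = k *: grad f x.
  by case: f2 => _ [df _]; apply/rowP => i; rewrite !mxE pdxZ.
exact: hb.
Qed.

Lemma C12per_C2 (T : R) (phi : R -> V -> R) (t : R) : C12per T phi -> C2 (phi
  t).
Proof.
move=> p; have [c _ c1 _ _ _ _ _ _] := C12per_family p.
case: p => [_ [_ [_ [_ [_ [dv1 [_ [dv2 c2]]]]]]]].
split; first exact: continuous_section c.
split; first by move=> i x; exact: dv1.
split; first by move=> i; exact: (@continuous_section _ _ _ (fun t =>
  pdx i (phi t)) t (c1 i)).
split; first by move=> i j x; exact: dv2.
by move=> i j; exact: (@continuous_section _ _ _ (fun t =>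
  pdx j (pdx i (phi t))) t (c2 i j)).
Qed.

End torus.

(** * Integral relations satisfied by a solution of the eigenvalue equation *)

Section torus.
Context {R : realType} {d : nat}.
Local Notation V := 'rV[R]_d.

Lemma torus_int_sum (I : finType) (F : I -> V -> R) :
  (forall i, continuous (F i)) ->
  torus_int (fun x => \sum_i F i x) = \sum_i torus_int (F i).
Proof.
move=> cF; elim: (index_enum I) => [|i s ih].
  rewrite big_nil -[RHS](@torus_int_cst R d); congr torus_int.
  by apply/funext => x; rewrite big_nil.
rewrite big_cons -ih -torus_intD//.
  by congr torus_int; apply/funext => x; rewrite big_cons.
elim: s {ih} => [|j s ih]; first by under eq_fun do rewrite big_nil;
  exact: continuous_cstf.
by under eq_fun do rewrite big_cons; exact: continuous_addf.
Qed.

Section solution.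
Variables (T lambda : R) (H : V -> R) (g phi : R -> V -> R).
Hypotheses (T0 : 0 < T) (phi_reg : C12per T phi).
Hypothesis cg : continuous (fun q : R * V => g q.1 q.2).
Hypothesis eqn : forall t x,
  lambda + dt phi t x - lapl (phi t) x + H (grad (phi t) x) = - g t x.

Let fam := C12per_family phi_reg.

Let sec (f : R -> V -> R) t :
  continuous (fun q : R * V => f q.1 q.2) -> continuous (f t).
Proof. exact: continuous_section. Qed.

Let cphi : continuous (fun q : R * V => phi q.1 q.2).
Proof. by case: fam. Qed.

Let cphit : continuous (fun q : R * V => dt phi q.1 q.2).
Proof. by case: fam. Qed.

Let cphi1 i : continuous (fun q : R * V => pdx i (phi q.1) q.2).
Proof. by case: fam. Qed.

Let cphi2 i : continuous (fun q : R * V => pdx i (pdx i (phi q.1)) q.2).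
Proof. by case: fam. Qed.

Let cphi2t i t : continuous (pdx i (pdx i (phi t))).
Proof. exact: (@sec (fun t => pdx i (pdx i (phi t)))). Qed.

Let clapl t : continuous (lapl (phi t)).
Proof. by rewrite /lapl; solve_continuous. Qed.

(** The Laplacian integrates to zero over the torus and the time derivative over a period. *)
Lemma int_hamiltonian :
  itv_int 0 T (fun t => torus_int (fun x => H (grad (phi t) x)))
  = - lambda * T - itv_int 0 T (fun t => torus_int (g t)).
Proof.
have cgt t := sec (t := t) cg; have cpt t := sec (t := t) cphit.
have HE t : torus_int (fun x => H (grad (phi t) x)) =
    - lambda + -1 * torus_int (g t) + -1 * torus_int (dt phi t).
  have -> : (fun x => H (grad (phi t) x)) = (fun x =>
      - lambda + -1 * g t x + -1 * dt phi t x + lapl (phi t) x).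
    by apply/funext => x; have := eqn t x; lra.
  rewrite torus_intD; try by solve_continuous.
  rewrite torus_intD; try by solve_continuous.
  rewrite torus_intD; try by solve_continuous.
  rewrite torus_int_cst !torus_intZ//.
  suff -> : torus_int (lapl (phi t)) = 0 by rewrite addr0.
  rewrite torus_int_sum// big1// => i _.
  apply: (@torus_int_pdx _ _ i (pdx i (phi t))) => //.
  - exact: (@sec (fun t => pdx i (phi t))).
  - exact: c12_2 fam i t.
  - by move=> x; exact: xperiodic_has_pdx (c12_per fam t) (c12_1 fam i t) i x.
have c3 : continuous (fun t => torus_int (g t)) by exact: continuous_torus_int.
have c4 : continuous (fun t => torus_int (dt phi t)) by exact:
  continuous_torus_int.
under eq_Rintegral do rewrite HE.
rewrite itv_intD; try by solve_continuous.
rewrite itv_intD; try by solve_continuous.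
rewrite !itv_intZ// itv_int_cst ?(ltW T0)// subr0 (C12family_int_dt T0 fam).
by rewrite mulr0 addr0 mulN1r.
Qed.

Lemma weighted_le r rt r1 r2 B :
  C12family T r rt r1 r2 -> (forall t x, 0 <= r t x) ->
  (forall t, torus_int (r t) = 1) -> (forall p, 0 <= H p) ->
  (forall t x, 0 <= t <= T -> `|rt t x + \sum_i r2 i t x| <= B) ->
  itv_int 0 T (fun t => torus_int (fun x => r t x * g t x)) <=
  - lambda * T +
    B * itv_int 0 T (fun t => torus_int (fun x =>
      `|phi t x - torus_int (phi t)|)).
Proof.
move=> fr r_ge0 r_int H_ge0 hB.
have [cr crt cr1 cr2 drt dr1 dr2 pr rT] := fr.
have cc : continuous (fun t => torus_int (phi t)) by exact:
  continuous_torus_int.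
have cgt t := sec (t := t) cg; have cpt t := sec (t := t) cphit.
have cp t := sec (t := t) cphi.
have crs t := sec (t := t) cr; have crts t := sec (t := t) crt.
have cr1s i t := sec (t := t) (cr1 i); have cr2s i t := sec (t := t) (cr2 i).
have cphi1t i t : continuous (pdx i (phi t)).
  exact: (@sec (fun t => pdx i (phi t))).
have rt0 t : torus_int (rt t) = 0.
  have := is_derive_torus_int cr crt drt t.
  rewrite (_ : (fun u => _) = cst 1); last by apply/funext.
  by move=> h; apply: is_derive_unique h _; exact: is_derive_cst.
have r20 i t : torus_int (r2 i t) = 0.
  apply: (@torus_int_pdx _ _ i (r1 i t)) => // x.
  exact: xperiodic_has_pdx (pr t) (dr1 i t) i x.
(* Up to sign, [w] is the adjoint heat operator applied to [r]. It has zero mean because the mass of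
   [r] is constant, so [phi] may be replaced by its deviation from the spatial mean. *)
pose w t x := rt t x + \sum_i r2 i t x.
have cw : continuous (fun q : R * V => w q.1 q.2) by rewrite /w;
  solve_continuous.
have cwt t := sec (t := t) cw.
have w0 t : torus_int (w t) = 0.
  by rewrite torus_intD ?torus_int_sum ?rt0 ?big1 ?addr0//; solve_continuous.
have frp := C12familyM fr fam.
(* This is the time derivative of [r * phi], whose space-time integral vanishes by periodicity. *)
pose q t x := r t x * dt phi t x + phi t x * rt t x.
have cq : continuous (fun p : R * V => q p.1 p.2) by exact: c12_contt frp.
have cqt t := sec (t := t) cq.
pose a t := torus_int (fun x => `|phi t x - torus_int (phi t)|).
have ca : continuous a.
  apply: (@continuous_torus_int _ _ _ (fun t x =>
    `|phi t x - torus_int (phi t)|)).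
  by have := continuous_left (U := V) cc => h; solve_continuous.
have wle t : 0 <= t <= T -> torus_int (fun x => w t x * phi t x) <= B * a t.
  move=> tT; rewrite -torus_intZ; last by solve_continuous.
  have -> : torus_int (fun x => w t x * phi t x) =
      torus_int (fun x => w t x * (phi t x - torus_int (phi t))).
    have -> : (fun x => w t x * (phi t x - torus_int (phi t))) =
        (fun x => w t x * phi t x + - torus_int (phi t) * w t x).
      by apply/funext => x; ring.
    by rewrite torus_intD ?torus_intZ ?w0 ?mulr0 ?addr0//; solve_continuous.
  apply: le_torus_int => [||x]; try by solve_continuous.
  apply: le_trans (ler_norm _) _; rewrite normrM ler_wpM2r//.
  exact: hB.
have ibp t : torus_int (fun x => r t x * lapl (phi t) x) =
    torus_int (fun x => (\sum_i r2 i t x) * phi t x).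
  under eq_fun do rewrite mulr_sumr.
  under [in RHS]eq_fun do rewrite mulr_suml.
  rewrite !torus_int_sum; try by move=> i; solve_continuous.
  apply: eq_bigr => i _.
  apply: (@torus_int_ibp2 _ _ i _ (r1 i t) _ _ (pdx i (phi t))) => //.
  - exact: c12_1 fam i t.
  - exact: c12_2 fam i t.
  - exact: c12_per fam t.
(* After integration by parts, the two integrands differ exactly by [r * H (grad phi)], which is
   nonnegative. *)
have le_t t : torus_int (fun x => r t x * g t x) <=
    - lambda + -1 * torus_int (q t) + torus_int (fun x => w t x * phi t x).
  have -> : torus_int (fun x => w t x * phi t x) =
      torus_int (fun x => phi t x * rt t x) +
      torus_int (fun x => r t x * lapl (phi t) x).
    rewrite ibp -torus_intD; try by solve_continuous.
    by congr torus_int; apply/funext => x; rewrite /w; ring.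
  have -> : - lambda = torus_int (fun x => - lambda * r t x).
    by rewrite torus_intZ// r_int mulr1.
  rewrite -[-1 * _]torus_intZ// -!torus_intD; try by solve_continuous.
  apply: le_torus_int => [||x]; try by solve_continuous.
  have := eqn t x; have := mulr_ge0 (r_ge0 t x) (H_ge0 (grad (phi t) x)).
  by rewrite /q; nra.
have cw2 : continuous (fun t => torus_int (fun x => w t x * phi t x)).
  by apply: (@continuous_torus_int _ _ _ (fun t x => w t x * phi t x));
    solve_continuous.
have cq2 : continuous (fun t => torus_int (q t)) by exact: continuous_torus_int.
apply: (@le_trans _ _ (itv_int 0 T
    (fun t => - lambda + -1 * torus_int (q t) + B * a t))).
  apply: le_itv_int; [|by solve_continuous|].
    by apply: (@continuous_torus_int _ _ _ (fun t x => r t x * g t x));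
      solve_continuous.
  by move=> t tT; apply: le_trans (le_t t) _; rewrite lerD2l wle.
rewrite itv_intD; try by solve_continuous.
rewrite itv_intD; try by solve_continuous.
rewrite !itv_intZ// itv_int_cst ?(ltW T0)// subr0 (C12family_int_dt T0 frp).
by rewrite mulr0 addr0.
Qed.

End solution.
End torus.

(** * Choice of the threshold for [eps], and the contradiction *)

Theorem theorem1p2 (R : realType) (d : nat) (T : R) (H : 'rV[R]_d -> R)
    (m : R -> 'rV[R]_d -> R) :
  0 < T -> assumptionH H -> C12per T m ->
  0 < Rintegral (@lebesgue_measure R) `[0, T] (xmax m) ->
  forall M : R, exists2 delta : R, 0 < delta &
    forall (eps lambda : R), 0 < eps -> eps < delta ->
      is_eigenvalue T H (fun t x => eps^-1 * m t x) lambda -> lambda < - M.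
Proof.
move=> T0 hH mreg S0 M.
have [kappa kappa0 [beta /andP[b0 b1] osc]] := oscillation_le hH.
case: hH => [[cH _] [H0 [Hpos _]]].
have H_ge0 p : 0 <= H p.
  by have [->|/Hpos/ltW//] := eqVneq p 0; rewrite H0.
have [r [rt [r1 [r2 [fr r_ge0 r_int]]]]] := test_density T0 mreg S0.
set sigma := Rintegral _ _ _ => sigma0.
have [cm _ _ _ _ _ _ pm _] := C12per_family mreg.
have [cr crt _ cr2 drt dr1 dr2 pr _] := fr.
have [B B0 hB] : exists2 B, 0 <= B & forall t x, 0 <= t <= T ->
    `|rt t x + \sum_i r2 i t x| <= B.
  apply: (@torus_bounded _ _ (fun t x => rt t x + \sum_i r2 i t x));
    first by solve_continuous.
  move=> t j x; congr (_ + _); first exact: (xperiodic_dt pr drt).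
  apply: eq_bigr => i _.
  have p1 := xperiodic_has_pdx (pr t) (dr1 i t).
  exact: xperiodic_has_pdx p1 (dr2 i t) j x.
have [Bm Bm0 hBm] := torus_bounded 0 T cm pm.
pose N := `|M|; have N0 : 0 <= N by exact: normr_ge0.
(* [C] will bound [eps^beta] times the oscillation: the first [T] comes from the [- 1] in
   [oscillation_le], the rest is the energy bound divided by [kappa]. *)
pose C := T + T * (N + Bm) / kappa.
have T0' := ltW T0; have kappa0' := ltW kappa0.
have C0 : 0 <= C.
  by apply: addr_ge0 => //; apply: divr_ge0 => //; apply: mulr_ge0 => //; lra.
pose D := N * T + B * C.
have D0 : 0 <= D by apply: addr_ge0; exact: mulr_ge0.
pose y := sigma / (D + 1).
have y0 : 0 < y by rewrite divr_gt0//; lra.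
(* The bound 1 permits the scaling of [H]; the other forces [eps^(1 - beta) < y], that is
   [eps^(1 - beta) * (D + 1) < sigma]. The [+ 1] keeps the quotient meaningful when [D = 0]. *)
exists (Num.min 1 (y `^ (1 - beta)^-1)).
  by rewrite lt_min ltr01 powR_gt0.
move=> eps lambda e0; rewrite lt_min => /andP[e1 ey] [phi [preg eqn]].
rewrite ltNge; apply/negP => lM.
have lN : - lambda <= N by have := ler_norm M; rewrite -/N; lra.
pose s := eps `^ (1 - beta); pose k := eps `^ beta.
have s0 : 0 < s by exact: powR_gt0.
have k0 : 0 < k by exact: powR_gt0.
have sk : eps = s * k.
  rewrite /s /k -powRD; last by apply/implyP => _; rewrite gt_eqF.
  by rewrite subrK powRr1// ltW.
have sy : s < y.
  rewrite -[y]powRr1 ?(ltW y0)// -(@mulVf _ (1 - beta)); last by apply/eqP; lra.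
  rewrite powRrM; apply: gt0_ltr_powR; rewrite ?nnegrE ?powR_ge0 ?(ltW e0)//.
  by lra.
have es : eps <= s.
  rewrite -[leLHS]powRr1 ?(ltW e0)//; apply: ger_powR; last by lra.
  by rewrite e0 ltW.
have cg : continuous (fun q : R * 'rV[R]_d =>
  eps^-1 * m q.1 q.2) by solve_continuous.
have [cphi _ _ _ _ _ _ pphi _] := C12per_family preg.
have energy := int_hamiltonian T0 preg cg eqn.
have weighted := weighted_le T0 preg cg eqn fr r_ge0 r_int H_ge0 hB.
have cmt t : continuous (m t) by exact: continuous_section cm.
have cIm : continuous (fun t => torus_int (m t)) by exact: continuous_torus_int.
have crm : continuous (fun q : R * 'rV[R]_d =>
  r q.1 q.2 * m q.1 q.2) by solve_continuous.
(* Multiplying by [eps] cancels the factor [eps^-1] in front of [m], and [eps < 1] absorbs the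
   contribution of [lambda]. *)
have energy_le : eps * itv_int 0 T (fun t => torus_int (fun x =>
  H (grad (phi t) x)))
    <= T * (N + Bm).
  rewrite energy; under eq_Rintegral do rewrite torus_intZ//.
  rewrite itv_intZ// mulrBr mulVKf ?gt_eqF//.
  have h1 : - Bm * T <= itv_int 0 T (fun t => torus_int (m t)).
    rewrite -[T in _ * T]subr0 -itv_int_cst ?(ltW T0)//;
      apply: le_itv_int => //.
      exact: continuous_cstf.
    move=> t tT; rewrite -[leLHS](@torus_int_cst R d);
      apply: le_torus_int => //.
      exact: continuous_cstf.
    by move=> x; have := hBm t x tT; rewrite ler_norml => /andP[].
  have h2 : eps * (- lambda * T) <= N * T.
    apply: (@le_trans _ _ (eps * (N * T))).
      by rewrite ler_pM2l// ler_pM2r.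
    by have := ler_wpM2r (mulr_ge0 N0 T0') (ltW e1); rewrite mul1r.
  by lra.
set A := itv_int 0 T (fun t => torus_int (fun x => `|phi t x - _|)) in weighted.
have cIphi : continuous (fun t => torus_int (phi t)).
  exact: continuous_torus_int.
have ca : continuous (fun t => torus_int (fun x =>
  `|phi t x - torus_int (phi t)|)).
  apply: (@continuous_torus_int _ _ _ (fun t x =>
    `|phi t x - torus_int (phi t)|)).
  by have := continuous_left (U := 'rV[R]_d) cIphi => h; solve_continuous.
have ch : continuous (fun t => torus_int (fun x => H (grad (phi t) x))).
  apply: (@continuous_torus_int _ _ _ (fun t x => H (grad (phi t) x))).
  case: preg => [_ [_ [_ [_ [_ [_ [c1 _]]]]]]].
  exact: (@continuous_compose _ _ _ (fun q : R * 'rV[R]_d =>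
    grad (phi q.1) q.2) H c1 cH).
have kA : k * A <= C.
  have : itv_int 0 T (fun t =>
      kappa * (k * torus_int (fun x => `|phi t x - torus_int (phi t)|) + - 1))
        <=
      itv_int 0 T (fun t => eps * torus_int (fun x => H (grad (phi t) x))).
    apply: le_itv_int; [by solve_continuous..|] => t _.
    by apply: osc => //; [rewrite e0|exact: C12per_C2 preg].
  rewrite !itv_intZ//; last by solve_continuous.
  rewrite itv_intD; try by solve_continuous.
  rewrite itv_intZ// itv_int_cst// subr0 mulN1r -/A => h.
  have := le_trans h energy_le; rewrite -ler_pdivlMl// mulrC /C; lra.
have : eps^-1 * sigma <= N * T + B * A.
  apply: (@le_trans _ _ (- lambda * T + B * A));
    last by rewrite lerD2r ler_pM2r.
  apply: le_trans weighted.
  rewrite -itv_intZ; last first.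
    exact: (@continuous_torus_int _ _ _ (fun t x => r t x * m t x)).
  rewrite le_eqVlt; apply/orP; left; apply/eqP; apply: eq_Rintegral => t _.
  rewrite -torus_intZ; last first.
    exact: (@continuous_section _ _ _ (fun t x => r t x * m t x)).
  by congr torus_int; apply/funext => x; ring.
rewrite -(ler_pM2l e0) mulVKf ?gt_eqF// => le_sigma.
(* Both error terms are brought to the common factor [s = eps^(1 - beta)], giving [sigma <= s * D],
   against [s * (D + 1) < sigma]. *)
have h1 : eps * (N * T) <= s * (N * T) by rewrite ler_wpM2r// mulr_ge0.
have h2 : eps * (B * A) <= s * (B * C).
  by rewrite sk -mulrA ler_pM2l// mulrCA ler_wpM2l.
have : s * (D + 1) < sigma by rewrite -ltr_pdivlMr//; lra.
rewrite /D; lra.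
Qed.
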